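(* Let $h(n)$ be the height of the tower factorization of the positive integer $n$, and for each integer $k\ge 1$ let $d_k=\lim_{N\to\infty}\frac1N\#\{n\le N: h(n)=k\}$ be the natural density of the set of positive integers of height $k$. Then the series $\sum_{k\ge1}k\,d_k$ converges, the limit below exists, and $$\lim_{N\to\infty}\frac1N\sum_{n\le N}h(n)=\sum_{k=1}^\infty k\,d_k.$$
   Context: Every integer $n\ge 2$ is written in canonical form $n=p_1^{a_1}\cdots p_r^{a_r}$ with primes $p_1<\cdots<p_r$ and positive integers $a_i$. Factoring each exponent larger than $1$ into prime powers, then doing the same with the new exponents, and so on, gives the tower factorization of $n$; its height $h(n)$ is the number of floors in it. Equivalently, $h(n)=1$ if and only if $n$ is square-free (in particular $h(1)=1$), and if $n$ is not square-free then $h(n)=1+\max\{h(a_i): a_i\ge 2\}$. For example, $h(p^2)=2$ for $p$ prime, and $h(2^{2^{2^2}})=4$. The densities $d_k$ exist for all $k\ge 1$. *)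

(* Defs.v *)
From mathcomp Require Import all_boot all_order all_algebra.
From mathcomp Require Import all_classical all_reals all_analysis.

Set Implicit Arguments.
Unset Strict Implicit.
Unset Printing Implicit Defensive.

Import Order.TTheory GRing.Theory Num.Theory.
Import numFieldNormedType.Exports.

Local Open Scope nat_scope.

(* [Tower [:: (p1, t1); ...; (pr, tr)]] is the product of the p_i raised to
   the value of t_i. [Tower [::]] stands for the number 1, so that an exponent
   equal to 1 contributes no floor. *)
Inductive tower : Type := Tower of seq (nat * tower).

Fixpoint tower_value (t : tower) : nat :=
  let: Tower s := t in foldr (fun q m => q.1 ^ tower_value q.2 * m) 1 s.

Fixpoint floors (t : tower) : nat :=
  let: Tower s := t in foldr (fun q m => maxn (floors q.2).+1 m) 0 s.

Fixpoint tower_build (fuel n : nat) : tower :=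
  if fuel is fuel'.+1
  then Tower [seq (q.1, tower_build fuel' q.2) | q <- prime_decomp n]
  else Tower [::].

(* [n] is enough fuel: the exponents of a positive [n] are less than [n]. *)
Definition tower_factorization (n : nat) : tower := tower_build n n.

(* The [maxn] only implements the convention that 1 has height 1. *)
Definition height (n : nat) : nat := maxn 1 (floors (tower_factorization n)).

Lemma tower_build_fuel f n : n <= f -> tower_build f n = tower_factorization n.
Proof.
rewrite /tower_factorization.
have H m : forall f g, m <= f -> m <= g -> tower_build f m = tower_build g m.
  elim/ltn_ind: m => -[|m] IH [|f'] [|g] //= hf hg.
  congr Tower; apply/eq_in_map => -[p e] /mem_prime_decomp [pp e0 pem] /=.
  have em : e < m.+1.
    by apply: leq_trans (dvdn_leq _ pem) => //; apply/ltn_expl/prime_gt1.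
  by rewrite (IH e em f' g) // -ltnS; apply: leq_trans em _.
by move=> hf; apply: H.
Qed.

Lemma tower_factorizationE n :
  tower_factorization n =
  Tower [seq (p, tower_factorization (logn p n)) | p <- primes n].
Proof.
case: n => [|n]; first by [].
rewrite {1}/tower_factorization [tower_build _ _]/= prime_decompE -map_comp.
congr Tower; apply: eq_map => p /=.
by rewrite tower_build_fuel // -ltnS; apply: ltn_logl.
Qed.

Lemma tower_factorizationK n : 0 < n -> tower_value (tower_factorization n) = n.
Proof.
elim/ltn_ind: n => n IH n0; rewrite tower_factorizationE /=.
rewrite [RHS]prod_prime_decomp // prime_decompE big_map unlock /= foldr_map /=.
have: all (fun p => 0 < logn p n) (primes n).
  by apply/allP => p; rewrite logn_gt0.
by elim: (primes n) => //= p s IHs /andP [p0 /IHs ->]; rewrite IH // ltn_logl.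
Qed.

Lemma floors_tower n :
  floors (tower_factorization n) =
  \max_(p <- primes n) (floors (tower_factorization (logn p n))).+1.
Proof. by rewrite tower_factorizationE /= unlock foldr_map. Qed.

Lemma floors_tower_gt0 n : 1 < n -> 0 < floors (tower_factorization n).
Proof.
move=> n1; rewrite floors_tower.
apply: (@leq_trans (floors (tower_factorization (logn (pdiv n) n))).+1) => //.
apply: (@leq_bigmax_seq _ _ xpredT
  (fun p => (floors (tower_factorization (logn p n))).+1)) => //.
by rewrite mem_primes pdiv_prime // pdiv_dvd (ltnW n1).
Qed.

Lemma heightE n : 1 < n -> height n = floors (tower_factorization n).
Proof. by move=> n1; apply/maxn_idPr/floors_tower_gt0. Qed.

Lemma height_eq1 n : 0 < n ->
  height n = 1 <-> forall p, prime p -> ~~ (p ^ 2 %| n).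
Proof.
move=> n0; split=> [h1 p pp|sf].
  apply/negP => /[dup] p2n; rewrite pfactor_dvdn // => l2.
  have pn : p \in primes n by rewrite -logn_gt0 (ltnW l2).
  have: (floors (tower_factorization (logn p n))).+1 <= height n.
    rewrite leq_max; apply/orP; right; rewrite (floors_tower n).
    exact: (@leq_bigmax_seq _ _ xpredT
      (fun p => (floors (tower_factorization (logn p n))).+1)).
  by rewrite h1 ltnNge floors_tower_gt0.
apply/eqP; rewrite eqn_leq leq_maxl andbT geq_max leqnn /= floors_tower.
apply/bigmax_leqP_seq => p; rewrite mem_primes => /and3P[pp _ pn] _.
have := sf p pp; rewrite pfactor_dvdn // -leqNgt => l1.
by case: (logn p n) l1 => [|[]].
Qed.

Lemma height_rec n : 0 < n -> ~ (forall p, prime p -> ~~ (p ^ 2 %| n)) ->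
  height n = (\max_(p <- primes n | 2 <= logn p n) height (logn p n)).+1.
Proof.
move=> n0 nsf.
have [q qn q2] : exists2 q, q \in primes n & 2 <= logn q n.
  apply: contrapT => H; apply: nsf => p pp; apply/negP.
  rewrite pfactor_dvdn // => l2; apply: H; exists p => //.
  by rewrite -logn_gt0 (ltnW l2).
have n1 : 1 < n by rewrite (leq_trans q2) // ltnW // ltn_logl.
rewrite heightE // (floors_tower n); apply/eqP; rewrite eqn_leq; apply/andP; split.
  apply/bigmax_leqP_seq => p pn _; rewrite ltnS.
  have [l2|l1] := leqP 2 (logn p n).
    rewrite -heightE //.
    exact: (@leq_bigmax_seq _ _ (fun p => 2 <= logn p n)
      (fun p => height (logn p n))).
  by case: (logn p n) l1 => [|[]].
have sup p : p \in primes n -> 2 <= logn p n ->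
    height (logn p n) <
    \max_(p <- primes n) (floors (tower_factorization (logn p n))).+1.
  move=> pn l2; rewrite heightE //.
  exact: (@leq_bigmax_seq _ _ xpredT
    (fun p => (floors (tower_factorization (logn p n))).+1)).
apply: (@leq_ltn_trans
  (\max_(p <- primes n) (floors (tower_factorization (logn p n))).+1).-1).
  apply/bigmax_leqP_seq => p pn l2.
  by rewrite -ltnS prednK ?sup // (leq_trans _ (sup _ pn l2)).
by rewrite ltn_predL (leq_trans _ (sup _ qn q2)).
Qed.

Local Open Scope ring_scope.

(* [(\sum_(n in A, 1 <= n <= N) 1) / N]; the value at [N = 0] is [0]. *)
Definition proportion (R : realType) (A : pred nat) (N : nat) : R :=
  (count A (iota 1 N))%:R / N%:R.

(* Only meaningful when [proportion A] converges, as [limn] is total. *)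
Definition natural_density (R : realType) (A : pred nat) : R :=
  limn (@proportion R A).

Definition height_density (R : realType) (k : nat) : R :=
  natural_density R (fun n => height n == k).

(* Main.v *)
Require Import Defs.
From mathcomp Require Import all_boot all_order all_algebra.
From mathcomp Require Import all_classical all_reals all_analysis.
From mathcomp Require Import zify ring lra.
Import Order.TTheory GRing.Theory Num.Theory.
Import numFieldNormedType.Exports.
Local Open Scope classical_set_scope.
Local Open Scope ring_scope.

Set Implicit Arguments.
Unset Strict Implicit.
Unset Printing Implicit Defensive.

(** Everything rests on one estimate: the integers [n <= N] that have a square
divisor [d ^ 2] with [D <= d] number at most [2 * N / D], since
[\sum_(D <= d) 1 / d ^ 2 <= 2 / D] ([count_square_dvdn]). It is used twice.

Existence of the densities. The height of [n] depends only on those exponents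
of [n] that are at least [2]. If [n] has no square divisor [d ^ 2] with
[D <= d], these exponents are read off from the gcd of [n] and
[Q := D`! ^ (2 * D)], so that [height n = height (gcdn n Q)] ([height_gcdn]).
The right-hand side is periodic in [n], so each of its values is taken with a
density; hence the proportion of integers of height [k] is eventually within
any prescribed distance of some constant, that is, it is a Cauchy sequence
([proportion_height_cvg]).

Domination. Since [4 * (height n - 1) <= n], an integer of height [k] has an
exponent of size at least [4 * (k - 2)], and therefore a square divisor
[d ^ 2] with [4 ^ (k - 2) <= d] ([height_square_dvdn]). So [k] times the
proportion of integers [n <= N] of height [k] is at most [32 / 2 ^+ k],
uniformly in [N]. The mean of [height] over [n <= N] is the sum over [k] of
these weighted proportions, and a dominated convergence argument for series
([tannery]) allows the limit in [N] to be taken term by term. *)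

(** * Heights and square divisors *)

Lemma height_gt0 n : (0 < height n)%N.
Proof. by rewrite leq_max. Qed.

(** Heights through exponents, for every [k]: with [k = 0] both sides say that
[n] is squarefree, as heights are positive. *)
Lemma height_leS n k : (0 < n)%N ->
  (height n <= k.+1)%N <->
  forall p, prime p -> (2 <= logn p n)%N -> (height (logn p n) <= k)%N.
Proof.
move=> n0; have [sf|nsf] := EM (forall p, prime p -> ~~ (p ^ 2 %| n)%N).
  have /height_eq1 -> // : forall p, prime p -> ~~ (p ^ 2 %| n)%N by [].
  by split=> // _ p pp; rewrite -pfactor_dvdn // (negbTE (sf p pp)).
rewrite height_rec // ltnS; split=> [h p pp l2|h].
  apply: leq_trans h.
  apply: (@leq_bigmax_seq _ _ (fun p => 2 <= logn p n)%N
    (fun p => height (logn p n))) => //.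
  by rewrite -logn_gt0 ltnW.
apply/bigmax_leqP_seq => p; rewrite mem_primes => /and3P[pp _ _].
exact: h.
Qed.

Lemma height_geS n k : (0 < n)%N -> (k.+1 < height n)%N ->
  exists p, [/\ prime p, (2 <= logn p n)%N & (k < height (logn p n))%N].
Proof.
move=> n0 hk; apply: contrapT => H.
suff : (height n <= k.+1)%N by rewrite leqNgt hk.
apply/height_leS => // p pp l2; rewrite leqNgt; apply/negP => hl.
by apply: H; exists p.
Qed.

(** The height depends only on the exponents that are at least [2]. *)
Lemma eq_height m n : (0 < m)%N -> (0 < n)%N ->
  (forall p, prime p -> (2 <= logn p m)%N || (2 <= logn p n)%N ->
    logn p m = logn p n) ->
  height m = height n.
Proof.
have le_height a b : (0 < a)%N -> (0 < b)%N ->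
    (forall p, prime p -> (2 <= logn p a)%N || (2 <= logn p b)%N ->
      logn p a = logn p b) -> (height a <= height b)%N.
  move=> a0 b0 H; rewrite -(prednK (height_gt0 b)).
  apply/height_leS => // p pp l2; have e := H p pp; rewrite e ?l2 //.
  have /height_leS : (height b <= (height b).-1.+1)%N by rewrite prednK ?height_gt0.
  by apply => //; rewrite -e ?l2.
move=> m0 n0 H; apply/eqP; rewrite eqn_leq !le_height // => p pp.
by rewrite orbC => /H ->.
Qed.

(** A crude bound (the height actually grows like an iterated logarithm), but
already enough to make the tails geometric. *)
Lemma height_linear n : (0 < n)%N -> (4 * (height n).-1 <= n)%N.
Proof.
elim/ltn_ind: n => n IH n0.
case e: (height n) (height_gt0 n) => [//|[//|k]] _ /=.
have [p [pp l2 hl]] : exists p,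
    [/\ prime p, (2 <= logn p n)%N & (k < height (logn p n))%N].
  by apply: height_geS; rewrite // e.
have ln : (p ^ logn p n <= n)%N by rewrite dvdn_leq // pfactor_dvdnn.
have := IH _ (ltn_logl p n0) (ltnW l2).
have : (2 ^ logn p n <= p ^ logn p n)%N by rewrite leq_exp2r ?prime_gt1 // ltnW.
move: (logn p n) l2 hl ln => a l2 hl ln hp ha.
have {hp}ln : (2 ^ a <= n)%N := leq_trans hp ln.
case: a l2 hl ln ha => [|[|[|a]]] // _ hl ln ha; first lia.
have := @ltn_expl 2 a.+1 isT; rewrite !expnS in ln *; lia.
Qed.

Lemma height_le n : (0 < n)%N -> (height n <= n)%N.
Proof. by move=> n0; have := height_linear n0; lia. Qed.

Lemma square_pfactor_dvdn p n a b : (0 < n)%N -> prime p ->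
  (2 * b <= a)%N -> (a <= logn p n)%N -> ((p ^ b) ^ 2 %| n)%N.
Proof.
move=> n0 pp ba an; rewrite -expnM mulnC pfactor_dvdn //.
exact: leq_trans an.
Qed.

Lemma height_square_dvdn n k : (0 < n)%N -> (k <= height n)%N ->
  exists d, (4 ^ (k - 2) <= d)%N /\ (d ^ 2 %| n)%N.
Proof.
case: k => [|[|k]] n0 hk; [by exists 1%N; rewrite dvd1n..|].
have [p [pp l2 hl]] := height_geS n0 hk.
exists (p ^ (2 * k))%N; split; last first.
  apply: (@square_pfactor_dvdn p n (4 * k) (2 * k)) => //; first lia.
  apply: leq_trans (height_linear (ltnW l2)); lia.
rewrite !subSS subn0 expnM.
by case: k {hk hl} => // k; rewrite leq_exp2r // (@leq_exp2r 2 p 2) ?prime_gt1.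
Qed.

(** Without a large square divisor, the gcd with the fixed integer
[D`! ^ (2 * D)] keeps every exponent that is at least [2]. *)
Lemma height_gcdn D n : (0 < D)%N -> (0 < n)%N ->
  (forall d, (D <= d)%N -> ~~ (d ^ 2 %| n)%N) ->
  height (gcdn n (D`! ^ (2 * D))) = height n.
Proof.
move=> D0 n0 H; set Q := (D`! ^ (2 * D))%N.
have Q0 : (0 < Q)%N by rewrite expn_gt0 fact_gt0.
apply: eq_height => // [|p pp]; first by rewrite gcdn_gt0 n0.
(* If the gcd lowers the exponent of [p], then the square of [p ^ D] (when
   [p <= D]) or of [p] (when [D < p]) divides [n]. *)
rewrite logn_gcd // => l2; apply/minn_idPl; rewrite leqNgt; apply/negP => lt.
have {}l2 : (2 <= logn p n)%N by lia.
have [pD|Dp] := leqP p D.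
  have /negP := H _ (ltnW (ltn_expl D (prime_gt1 pp))); apply.
  apply: (@square_pfactor_dvdn p n (2 * D) D) => //.
  apply: leq_trans (ltnW lt); rewrite -pfactor_dvdn //.
  by apply: dvdn_exp2r; rewrite dvdn_fact // prime_gt0.
have /negP := H _ (ltnW Dp); apply.
by rewrite -(expn1 p); apply: (@square_pfactor_dvdn p n 2 1).
Qed.

(** * Counting and densities *)

Lemma count_iotaE (A : pred nat) N :
  count A (iota 1 N) = (\sum_(1 <= n < N.+1) A n)%N.
Proof.
rewrite -sum1_count big_mkcond /index_iota subSS subn0.
by apply: eq_bigr => n _; case: (A n).
Qed.

(** Integers with a large square divisor have small upper density. *)
Lemma count_square_dvdn (R : realType) (A : pred nat) D N : (0 < D)%N ->
  (forall n, (0 < n)%N -> A n -> exists d, (D <= d)%N /\ (d ^ 2 %| n)%N) ->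
  (count A (iota 1 N))%:R <= 2 / D%:R * N%:R :> R.
Proof.
move=> D0 H.
rewrite count_iotaE.
have le1 : (\sum_(1 <= n < N.+1) A n <= \sum_(D <= d < D + N) N %/ d ^ 2)%N.
  under [X in (_ <= X)%N]eq_bigr do rewrite divn_count_dvd.
  rewrite exchange_big_nat /=.
  rewrite big_nat_cond [X in (_ <= X)%N]big_nat_cond; apply: leq_sum => n.
  rewrite andbT => /andP[n0 nN].
  case An: (A n) => //; have [d [Dd dn]] := H n n0 An.
  rewrite (bigD1_seq d) ?iota_uniq //= ?dn ?leq_addr //.
  rewrite mem_index_iota Dd /=.
  have : (d ^ 2 <= n)%N by rewrite dvdn_leq.
  by rewrite -mulnn; nia.
(* [N %/ d ^ 2 <= N / d ^ 2 <= N * (2 / d - 2 / d.+1)], and the sum telescopes. *)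
apply: (@le_trans _ _ (\sum_(D <= d < D + N) N%:R * (2 / d%:R - 2 / d.+1%:R))).
  rewrite -(ler_nat R) in le1; apply: le_trans le1 _; rewrite natr_sum.
  rewrite big_nat_cond [leRHS]big_nat_cond; apply: ler_sum => d.
  rewrite andbT => /andP[Dd _]; have d0 := leq_trans D0 Dd.
  have dR : 1 <= d%:R :> R by rewrite ler1n.
  have d2 : 0 < (d ^ 2)%:R :> R by rewrite ltr0n expn_gt0 d0.
  apply: (@le_trans _ _ (N%:R / (d ^ 2)%:R)).
    by rewrite ler_pdivlMr // -natrM ler_nat leq_trunc_div.
  apply: ler_wpM2l => //.
  have -> : 2 / d%:R - 2 / d.+1%:R = 2 / (d%:R * (d%:R + 1)) :> R.
    rewrite -natr1; field; lra.
  rewrite natrX -div1r ler_pdivrMr ?exprn_gt0 //; last lra.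
  rewrite mulrAC ler_pdivlMr; nra.
rewrite -mulr_sumr (telescope_sumr_eq (fun d => - (2 / d%:R))) ?leq_addr //; last first.
  by move=> d _; rewrite opprK addrC.
rewrite mulrC ler_wpM2r // opprK addrC lerBlDr lerDl.
by rewrite divr_ge0.
Qed.

Lemma count_periodic (A : pred nat) Q m : (forall n, A (n + Q)%N = A n) ->
  count A (iota m Q) = count A (iota 0 Q).
Proof.
move=> H; elim: m => // m <-; case: Q H => // Q H.
rewrite -[Q.+1 in LHS]addn1 iotaD count_cat /= addn0 addnC; congr addn.
by rewrite addSn -addnS H.
Qed.

Lemma count_iotaM (A : pred nat) Q q : (forall n, A (n + Q)%N = A n) ->
  count A (iota 1 (q * Q)) = (q * count A (iota 0 Q))%N.
Proof.
move=> H; elim: q => // q IH.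
by rewrite mulSnr iotaD count_cat IH count_periodic // mulSnr.
Qed.

Lemma proportion_periodic (R : realType) (A : pred nat) Q : (0 < Q)%N ->
  (forall n, A (n + Q)%N = A n) ->
  @proportion R A @ \oo --> ((count A (iota 0 Q))%:R / Q%:R : R).
Proof.
move=> Q0 H; set c := count A _.
have QR : 0 < Q%:R :> R by rewrite ltr0n.
have cQ : (c <= Q)%N by rewrite -[leqRHS](size_iota 0) count_size.
apply/cvgrPdist_le => e e0; near=> N.
have N0 : 0 < N%:R :> R by rewrite ltr0n; near: N; exact: nbhs_infty_gt.
have NQ : Q%:R <= e * N%:R.
  by rewrite mulrC -ler_pdivrMr //; near: N; exact: nbhs_infty_ger.
rewrite /proportion (divn_eq N Q) iotaD count_cat count_iotaM // -/c.
rewrite -divn_eq.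
set x := count A (iota (1 + _) _).
have xr : (x <= N %% Q)%N by rewrite -[leqRHS](size_iota (1 + N %/ Q * Q)) count_size.
have rQ := ltn_pmod N Q0.
have NE : N%:R = (N %/ Q)%:R * Q%:R + (N %% Q)%:R :> R by rewrite -natrM -natrD -divn_eq.
(* [x] counts the incomplete last period, so both terms of the numerator below
   lie between [0] and [Q]. *)
have -> : c%:R / Q%:R - (N %/ Q * c + x)%:R / N%:R =
    (c%:R * (N %% Q)%:R / Q%:R - x%:R) / N%:R :> R.
  rewrite natrD natrM; apply: (mulIf (lt0r_neq0 N0)).
  rewrite mulrBl !divfK ?lt0r_neq0 // {1}NE.
  by field; rewrite lt0r_neq0.
rewrite normrM normfV (gtr0_norm N0) ler_pdivrMr //.
apply: le_trans NQ.
have rR : (N %% Q)%:R <= Q%:R :> R by rewrite ler_nat ltnW.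
have xR : x%:R <= Q%:R :> R by rewrite ler_nat (leq_trans xr) // ltnW.
have cR : c%:R / Q%:R <= 1 :> R by rewrite ler_pdivrMr // mul1r ler_nat.
have c0 : 0 <= c%:R / Q%:R :> R by rewrite divr_ge0.
rewrite mulrAC ler_norml; have r0 : 0 <= (N %% Q)%:R :> R by [].
have x0 : 0 <= x%:R :> R by [].
apply/andP; split; nra.
Unshelve. all: by end_near. Qed.

(** Predicates that agree away from the multiples of large squares have close
proportions, uniformly in [N]. *)
Lemma proportion_dist (R : realType) (A B : pred nat) D N : (0 < D)%N ->
  (forall n, (0 < n)%N -> (forall d, (D <= d)%N -> ~~ (d ^ 2 %| n)%N) ->
    A n = B n) ->
  `|proportion R A N - proportion R B N| <= 2 / D%:R.
Proof.
move=> D0 H; pose C := [pred n | A n != B n].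
have C2 n : (0 < n)%N -> C n -> exists d, (D <= d)%N /\ (d ^ 2 %| n)%N.
  move=> n0 /eqP Cn; apply: contrapT => nd; apply: Cn; apply: H => // d Dd.
  by apply/negP => dn; apply: nd; exists d.
have := @count_square_dvdn R C D N D0 C2.
have le s : (count A s <= count B s + count C s)%N /\
    (count B s <= count A s + count C s)%N.
  by elim: s => //= n s [IH1 IH2]; case: (A n) (B n) => -[]; lia.
have [] := le (iota 1 N); rewrite -!(ler_nat R) !natrD => l1 l2 l3.
case: N l1 l2 l3 => [|N] l1 l2 l3.
  by rewrite /proportion /= mul0r subrr normr0 divr_ge0.
have N0 : 0 < N.+1%:R :> R by rewrite ltr0n.
rewrite /proportion -mulrBl normrM normfV (gtr0_norm N0) ler_pdivrMr //.
apply: le_trans l3; rewrite ler_norml; lra.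
Qed.

(** Up to [2 / D], the proportion of height [k] is that of a predicate of period
[D`! ^ (2 * D)]; letting [D] grow shows that it is a Cauchy sequence. *)
Lemma proportion_height_cvg (R : realType) k :
  cvgn (@proportion R (fun n => height n == k)).
Proof.
apply: cauchy_cvg; apply/cauchy_exP => e e0.
have [D D0 De] : exists2 D : nat, (0 < D)%N & 2 / D%:R < e / 2.
  near \oo => D.
  have D0 : (0 < D)%N by near: D; exact: nbhs_infty_gt.
  exists D => //; rewrite ltr_pdivrMr ?ltr0n // mulrC -ltr_pdivrMr ?divr_gt0 //.
  by near: D; exact: nbhs_infty_gtr.
pose Q := (D`! ^ (2 * D))%N.
have Q0 : (0 < Q)%N by rewrite expn_gt0 fact_gt0.
pose B n := height (gcdn n Q) == k.
have pB := @proportion_periodic R B Q Q0.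
have /pB {}pB : forall n, B (n + Q)%N = B n by move=> n; rewrite /B gcdnC gcdnDr gcdnC.
exists ((count B (iota 0 Q))%:R / Q%:R).
rewrite /nbhs /=.
have e2 : 0 < e / 2 by rewrite divr_gt0.
move/cvgrPdist_lt : pB => /(_ _ e2); apply: filterS => N hN.
rewrite /ball /=.
have dN : `|proportion R B N - proportion R (fun n => height n == k) N| <= 2 / D%:R.
  by apply: proportion_dist => // n n0 nd; rewrite /B height_gcdn.
apply: le_lt_trans (ler_distD (proportion R B N) _ _) _.
rewrite (splitr e); apply: ltrD => //; exact: le_lt_trans De.
Unshelve. all: by end_near. Qed.

(** * Domination and exchange of limits *)

Lemma weighted_proportion_height_le (R : realType) k N :
  k%:R * proportion R (fun n => height n == k) N <= 32 / 2 ^+ k.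
Proof.
have [->|N0] := posnP N.
  by rewrite /proportion /= mul0r mulr0 divr_ge0 // exprn_ge0.
have NR : 0 < N%:R :> R by rewrite ltr0n.
have H n : (0 < n)%N -> height n == k ->
    exists d, (4 ^ (k - 2) <= d)%N /\ (d ^ 2 %| n)%N.
  by move=> n0 /eqP hk; apply: height_square_dvdn; rewrite // hk.
have D0 : (0 < 4 ^ (k - 2))%N by rewrite expn_gt0.
have := @count_square_dvdn R _ _ N D0 H.
rewrite -ler_pdivrMr // => cN.
apply: (@le_trans _ _ (k%:R * (2 / (4 ^ (k - 2))%:R))).
  by apply: ler_wpM2l.
have k2 : (k <= 2 ^ k)%N by rewrite ltnW // ltn_expl.
have k4 : (2 ^ k * 2 ^ k <= 16 * 4 ^ (k - 2))%N.
  rewrite -expnMn -[16%N]/(4 ^ 2)%N -expnD leq_exp2l //; lia.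
rewrite ler_pdivlMr ?exprn_gt0 // mulrA mulrAC ler_pdivrMr ?ltr0n //.
rewrite -natrX -!natrM ler_nat; nia.
Qed.

Lemma sum_proportion_height_tail (R : realType) N K L : (K <= L)%N ->
  \sum_(K <= k < L) k%:R * proportion R (fun n => height n == k) N
    <= 64 / 2 ^+ K.
Proof.
move=> KL; apply: (@le_trans _ _ (\sum_(K <= k < L) (64 / 2 ^+ k - 64 / 2 ^+ k.+1))).
  apply: ler_sum => k _; apply: le_trans (weighted_proportion_height_le R k N) _.
  rewrite exprS invfM; lra.
rewrite (telescope_sumr_eq (fun d => - (64 / 2 ^+ d))) //; last first.
  by move=> d _; rewrite opprK addrC.
rewrite opprK addrC lerBlDr lerDl divr_ge0 // exprn_ge0 //.
Qed.

(** Any upper limit [K] above [N] will do, because [height n <= n]. *)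
Lemma mean_heightE (R : realType) N K : (N < K)%N ->
  (\sum_(1 <= n < N.+1) (height n)%:R) / N%:R =
  \sum_(1 <= k < K) k%:R * proportion R (fun n => height n == k) N.
Proof.
move=> NK.
under [RHS]eq_bigr do rewrite /proportion count_iotaE mulrA.
rewrite -mulr_suml; congr (_ / _).
under [RHS]eq_bigr do rewrite natr_sum mulr_sumr.
rewrite exchange_big_nat /=.
rewrite big_nat_cond [RHS]big_nat_cond; apply: eq_bigr => n.
rewrite andbT => /andP[n0 nN].
rewrite (bigD1_seq (height n)) ?iota_uniq //=; last first.
  by rewrite mem_index_iota height_gt0 (leq_ltn_trans (height_le n0)) // (leq_trans nN).
rewrite eqxx mulr1 big1 ?addr0 // => k; rewrite eq_sym => /negbTE ->.
by rewrite mulr0.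
Qed.

(** Tannery's theorem for nonnegative terms, with the domination expressed by a
bound [t] on the tails that is uniform in [N]. *)
Lemma tannery (R : realType) (a : nat -> nat -> R) (d t m : nat -> R) :
  (forall N k, 0 <= a N k) ->
  (forall N K L, (K <= L)%N -> \sum_(K <= k < L) a N k <= t K) ->
  t @ \oo --> (0 : R) ->
  (forall k, a ^~ k @ \oo --> d k) ->
  (forall N, \forall K \near \oo, m N = \sum_(1 <= k < K) a N k) ->
  cvgn (fun K => \sum_(1 <= k < K) d k) /\
  m @ \oo --> limn (fun K => \sum_(1 <= k < K) d k).
Proof.
move=> a0 at_ t0 ad am; pose S K := \sum_(1 <= k < K) d k.
have sum_cvg K L : (fun N => \sum_(K <= k < L) a N k) @ \oo -->
    \sum_(K <= k < L) d k.
  by apply: cvg_big => [x|k _]; [exact: add_continuous|exact: ad].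
have d0 k : 0 <= d k.
  by apply: (cvgr_to_ge (ad k)); near=> N.
have dt K L : (K <= L)%N -> \sum_(K <= k < L) d k <= t K.
  move=> KL; apply: (cvgr_to_le (sum_cvg K L)); near=> N; exact: at_.
have Snd : nondecreasing_seq S.
  apply/nondecreasing_seqP => -[|n]; first by rewrite /S !big_geq.
  by rewrite /S [leRHS]big_nat_recr //= lerDl.
have Scvg : cvgn S.
  apply: (nondecreasing_is_cvgn Snd); exists (t 1%N) => _ [n _ <-].
  case: n => [|n]; last exact: dt.
  by have := dt _ _ (leqnn 1%N); rewrite /S !big_geq.
split=> //; apply/cvgrPdist_le => e e0.
have e3 : 0 < e / 3 by rewrite divr_gt0.
near \oo => K.
have tK : t K <= e / 3.
  near: K; exact: (cvgr_le _ t0).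
have K0 : (0 < K)%N by near: K; exact: nbhs_infty_gt.
have SK : `|limn S - S K| <= e / 3.
  by near: K; exact: ((cvgrPdist_le _ _).1 Scvg _ e3).
near=> N.
have aK : `|S K - \sum_(1 <= k < K) a N k| <= e / 3.
  by near: N; exact: ((cvgrPdist_le _ _).1 (sum_cvg 1%N K) _ e3).
have mK : `|\sum_(1 <= k < K) a N k - m N| <= e / 3.
  near \oo => L.
  have KL : (K <= L)%N by near: L; exact: nbhs_infty_ge.
  have -> : m N = \sum_(1 <= k < L) a N k by near: L; exact: am.
  rewrite (@big_cat_nat _ _ _ K 1 L) //= opprD addrA subrr sub0r normrN.
  rewrite ger0_norm ?sumr_ge0 //; exact: le_trans (at_ _ _ _ KL) tK.
move: SK aK mK; rewrite !ler_norml => /andP[? ?] /andP[? ?] /andP[? ?].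
apply/andP; split; lra.
Unshelve. all: by end_near. Qed.

Theorem mainTheorem2 (R : realType) :
  [/\ forall k : nat, (1 <= k)%N ->
        cvgn (@proportion R (fun n : nat => height n == k)),
      cvgn (fun K : nat => \sum_(1 <= k < K) k%:R * height_density R k : R)
    & (fun N : nat => (\sum_(1 <= n < N.+1) (height n)%:R) / N%:R : R) @ \oo -->
        limn (fun K : nat => \sum_(1 <= k < K) k%:R * height_density R k : R)].
Proof.
pose a N k : R := k%:R * proportion R (fun n => height n == k) N.
have [] := @tannery R a (fun k => k%:R * height_density R k)
  (fun K => 64 / 2 ^+ K)
  (fun N => (\sum_(1 <= n < N.+1) (height n)%:R) / N%:R).
- by move=> N k; rewrite mulr_ge0 // divr_ge0.
- by move=> N K L; exact: sum_proportion_height_tail.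
- under eq_fun do rewrite -exprVn.
  by apply: cvg_geometric; rewrite gtr0_norm ?invf_lt1 ?ltr1n.
- by move=> k; apply: cvgMr; exact: proportion_height_cvg.
- by move=> N; near=> K; apply: mean_heightE; near: K; exact: nbhs_infty_gt.
by move=> Scvg mcvg; split=> // k _; exact: proportion_height_cvg.
Unshelve. all: by end_near. Qed.
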